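(* Let $X_1,\dots,X_m\in\mathbb{M}_n$. Then, for all integers $j=0,1,\ldots$, $$ \lambda^{\downarrow}_{1+3j}\left(\left|\sum_{k=1}^m X_k\right|_{\mathrm{sym}}\right)\le \sqrt{2}\,\lambda^{\downarrow}_{1+j}\left(\sum_{k=1}^m |X_k|_{\mathrm{sym}}\right). $$
   Context: $\mathbb{M}_n$ is the space of complex $n\times n$ matrices. For $Z\in\mathbb{M}_n$, $|Z|=(Z^*Z)^{1/2}$ and $|Z|_{\mathrm{sym}}=\frac{|Z|+|Z^*|}{2}$. For a positive semidefinite $S\in\mathbb{M}_n$, $\lambda_1^{\downarrow}(S)\ge\lambda_2^{\downarrow}(S)\ge\cdots\ge\lambda_n^{\downarrow}(S)$ are its eigenvalues in nonincreasing order counted with multiplicity, with the convention $\lambda_k^{\downarrow}(S)=0$ for $k>n$. *)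

(* Defs.v *)
From mathcomp Require Import all_boot all_order all_algebra.
From mathcomp Require Import sesquilinear spectral complex.
From mathcomp Require Import reals.

Set Implicit Arguments.
Unset Strict Implicit.
Unset Printing Implicit Defensive.

Import Order.TTheory GRing.Theory Num.Theory.
Local Open Scope ring_scope.
Local Open Scope sesquilinear_scope.
Local Open Scope complex_scope.

Definition psdmx (R : realType) n (A : 'M[R[i]]_n) : Prop :=
  A \is hermsymmx /\ forall v : 'rV[R[i]]_n, 0 <= (v *m A *m v ^t*) 0 0.

(* Functional calculus: for A = P^-1 D P with P unitary and D diagonal, this is
   P^-1 D^(1/2) P.  It is only meant for positive semidefinite A, where it is
   the unique positive semidefinite square root of A (sqrtmx_unique below). *)
Definition sqrtmx (R : realType) n (A : 'M[R[i]]_n) : 'M[R[i]]_n :=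
  invmx (spectralmx A) *m diag_mx (map_mx sqrtC (spectral_diag A))
    *m spectralmx A.

Definition absmx (R : realType) n (Z : 'M[R[i]]_n) : 'M[R[i]]_n :=
  sqrtmx (Z ^t* *m Z).

Definition symabsmx (R : realType) n (Z : 'M[R[i]]_n) : 'M[R[i]]_n :=
  2^-1 *: (absmx Z + absmx (Z ^t*)).

Definition char_roots (R : realType) n (A : 'M[R[i]]_n) : seq R[i] :=
  sval (closed_field_poly_normal (char_poly A)).

(* Taking real parts loses nothing for Hermitian A, whose eigenvalues are real
   (eigs_char_poly below). *)
Definition eigs (R : realType) n (A : 'M[R[i]]_n) : seq R :=
  sort >=%R [seq complex.Re z | z <- char_roots A].

(* 1-based: for k > 0 the k-th largest eigenvalue, and 0 for k > n.
   The value at k = 0 is meaningless. *)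
Definition eig_down (R : realType) n (k : nat) (A : 'M[R[i]]_n) : R :=
  nth 0 (eigs A) k.-1.

Lemma char_roots_char_poly (R : realType) n (A : 'M[R[i]]_n) :
  char_poly A = \prod_(z <- char_roots A) ('X - z%:P).
Proof.
rewrite /char_roots; case: closed_field_poly_normal => r /= {1}->.
by rewrite (monicP (char_poly_monic A)) scale1r.
Qed.

Lemma size_eigs (R : realType) n (A : 'M[R[i]]_n) : size (eigs A) = n.
Proof.
have := size_char_poly A.
by rewrite char_roots_char_poly size_prod_XsubC size_sort size_map => -[].
Qed.

Lemma eigs_sorted (R : realType) n (A : 'M[R[i]]_n) : sorted >=%R (eigs A).
Proof. by apply: sort_sorted => x y; apply: ge_total. Qed.

Lemma invspectralmx (R : realType) n (A : 'M[R[i]]_n) :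
  invmx (spectralmx A) = (spectralmx A) ^t*.
Proof. exact/invmx_unitary/spectral_unitarymx. Qed.

Lemma hermE (R : realType) n (A : 'M[R[i]]_n) :
  A \is hermsymmx -> A ^t* = A.
Proof. by move/is_hermitianmxP => {2}->; rewrite expr0 scale1r. Qed.

Lemma herm_spectralE (R : realType) n (A : 'M[R[i]]_n) : A \is hermsymmx ->
  A = invmx (spectralmx A) *m diag_mx (spectral_diag A) *m spectralmx A.
Proof. by move=> /hermitian_normalmx/orthomx_spectralP. Qed.

Lemma herm_char_poly (R : realType) n (A : 'M[R[i]]_n) : A \is hermsymmx ->
  char_poly A = \prod_(i < n) ('X - (spectral_diag A 0 i)%:P).
Proof.
move=> Ah; have AE := herm_spectralE Ah.
set P := spectralmx A in AE; set D := diag_mx _ in AE.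
have Pu : P \in unitmx by exact: spectral_unit.
have -> : char_poly A = char_poly D.
  rewrite AE /char_poly /char_poly_mx !map_mxM.
  have Pu' : map_mx (@polyC R[i]) (invmx P) *m map_mx polyC P = 1%:M.
    by rewrite -map_mxM mulVmx // map_mx1.
  have -> : 'X%:M - map_mx polyC (invmx P) *m map_mx polyC D *m map_mx polyC P
     = map_mx polyC (invmx P) *m ('X%:M - map_mx polyC D) *m map_mx polyC P.
    by rewrite mulmxBr mulmxBl (scalar_mxC 'X (map_mx polyC (invmx P))) -(mulmxA 'X%:M)
       Pu' mulmx1.
  by rewrite !det_mulmx mulrAC -det_mulmx Pu' det1 mul1r.
rewrite char_poly_trig; last exact: diag_mx_is_trig.
by apply: eq_bigr => i _; rewrite mxE eqxx mulr1n.
Qed.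

Lemma herm_char_roots (R : realType) n (A : 'M[R[i]]_n) : A \is hermsymmx ->
  perm_eq (char_roots A) [seq spectral_diag A 0 i | i <- enum 'I_n].
Proof.
move=> Ah; have := char_roots_char_poly A.
rewrite (herm_char_poly Ah) => E.
apply: (@prod_XsubC_eq R[i]); rewrite -E big_map.
by rewrite big_enum.
Qed.

Lemma eigs_char_poly (R : realType) n (A : 'M[R[i]]_n) : A \is hermsymmx ->
  char_poly A = \prod_(x <- eigs A) ('X - (x%:C)%:P).
Proof.
move=> Ah; rewrite char_roots_char_poly.
rewrite [RHS](perm_big _ (permEl (perm_sort _ _))) /= big_map.
rewrite big_seq [RHS]big_seq; apply: eq_bigr => z.
rewrite (perm_mem (herm_char_roots Ah)) => /mapP[i _ ->].
have /mxOverP /(_ 0 i) := hermitian_spectral_diag_real Ah.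
by move=> /RRe_real ->.
Qed.

Lemma psd_spectral_ge0 (R : realType) n (A : 'M[R[i]]_n) (i : 'I_n) :
  psdmx A -> 0 <= spectral_diag A 0 i.
Proof.
case=> /herm_spectralE AE A0.
have := A0 (row i (spectralmx A)); rewrite {2}AE.
have Pu := spectral_unit A.
have -> : row i (spectralmx A) *m
   (invmx (spectralmx A) *m diag_mx (spectral_diag A) *m spectralmx A)
   = row i (diag_mx (spectral_diag A) *m spectralmx A).
  by rewrite -row_mul !mulmxA mulmxV // mul1mx.
have PP : spectralmx A *m (spectralmx A) ^t* = 1%:M.
  by apply/unitarymxP/spectral_unitarymx.
have -> : (row i (diag_mx (spectral_diag A) *m spectralmx A) *m
     (row i (spectralmx A)) ^t*) 0 0
   = (diag_mx (spectral_diag A) *m (spectralmx A *m (spectralmx A) ^t*)) i i.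
  rewrite mulmxA !mxE; apply: eq_bigr => j _; by rewrite !mxE.
by rewrite PP mulmx1 mxE eqxx mulr1n.
Qed.

Lemma conj_diag_psd (R : realType) n (P : 'M[R[i]]_n) (d : 'rV[R[i]]_n) :
  (forall i, 0 <= d 0 i) -> psdmx (P ^t* *m diag_mx d *m P).
Proof.
move=> d0; have dC : (diag_mx d) ^t* = diag_mx d.
  apply/matrixP=> i j; rewrite !mxE eq_sym.
  case: eqP => [->|_]; rewrite ?mulr1n ?mulr0n ?rmorph0 //.
  by apply/CrealP/ger0_real.
split.
  apply/is_hermitianmxP; rewrite expr0 scale1r.
  by rewrite !trmx_mul !map_mxM /= dC trmxCK mulmxA.
move=> v; rewrite !mulmxA -(mulmxA _ P).
have -> : P *m v ^t* = (v *m P ^t*) ^t* by rewrite trmx_mul map_mxM /= trmxCK.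
set w := v *m _.
rewrite mul_mx_diag mxE; apply: sumr_ge0 => i _; rewrite !mxE mulrAC.
by rewrite mulr_ge0 // mul_conjC_ge0.
Qed.

Lemma sqrtmx_psd (R : realType) n (A : 'M[R[i]]_n) :
  psdmx A -> psdmx (sqrtmx A).
Proof.
move=> Ap; rewrite /sqrtmx invspectralmx; apply: conj_diag_psd => i.
by rewrite mxE sqrtC_ge0 psd_spectral_ge0.
Qed.

Lemma sqrtmx_sqr (R : realType) n (A : 'M[R[i]]_n) :
  psdmx A -> sqrtmx A *m sqrtmx A = A.
Proof.
case=> Ah _; rewrite {3}(herm_spectralE Ah) /sqrtmx -!mulmxA; congr (_ *m _).
rewrite !mulmxA mulmxK ?spectral_unit //; congr (_ *m _).
rewrite mulmx_diag; congr diag_mx; apply/rowP => i.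
by rewrite !mxE -expr2 sqrtCK.
Qed.

(* Entrywise, D^2 T = T E^2 with D, E >= 0 diagonal gives D T = T E. *)
Lemma sqrtmx_unique (R : realType) n (A B : 'M[R[i]]_n) :
  psdmx A -> psdmx B -> B *m B = A -> B = sqrtmx A.
Proof.
move=> Ap Bp BA.
set d := map_mx sqrtC (spectral_diag A).
have SE : sqrtmx A = invmx (spectralmx A) *m diag_mx d *m spectralmx A by [].
have BE := herm_spectralE (proj1 Bp).
set P := spectralmx A in SE; set Q := spectralmx B in BE.
set e := spectral_diag B in BE.
have Pu : P \in unitmx by exact: spectral_unit.
have Qu : Q \in unitmx by exact: spectral_unit.
have d0 i : 0 <= d 0 i by rewrite mxE sqrtC_ge0 psd_spectral_ge0.
have e0 i : 0 <= e 0 i by exact: psd_spectral_ge0.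
have S2 : P *m A = diag_mx d *m diag_mx d *m P.
  by rewrite -(sqrtmx_sqr Ap) SE !mulmxA mulmxV // mul1mx mulmxK.
have B2 : A *m invmx Q = invmx Q *m (diag_mx e *m diag_mx e).
  by rewrite -BA BE !mulmxA !mulmxK.
pose T := P *m invmx Q.
have T2 : diag_mx d *m diag_mx d *m T = T *m (diag_mx e *m diag_mx e).
  by rewrite /T mulmxA -S2 -!mulmxA B2.
have T1 : diag_mx d *m T = T *m diag_mx e.
  apply/matrixP => i j; rewrite mul_diag_mx mul_mx_diag mxE [RHS]mxE.
  have /matrixP/(_ i j) := T2.
  rewrite !mulmx_diag mul_diag_mx mul_mx_diag mxE [RHS]mxE.
  rewrite [X in X * _ = _]mxE [X in _ = _ * X]mxE.
  have [->|Tn] := eqVneq (T i j) 0; first by rewrite !(mulr0, mul0r).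
  rewrite mulrC => /(mulfI Tn) /eqP; rewrite -!expr2 eqrXn2 //.
  by move=> /eqP ->; rewrite mulrC.
have := congr1 (fun M => invmx P *m M *m Q) T1.
rewrite /T !mulmxA mulVmx // mul1mx -BE => <-.
by rewrite mulmxKV.
Qed.

Lemma gram_psd (R : realType) n (Z : 'M[R[i]]_n) : psdmx (Z ^t* *m Z).
Proof.
have := @conj_diag_psd R n Z (const_mx 1).
rewrite diag_const_mx mulmx1; apply => i; by rewrite mxE ler01.
Qed.

Lemma absmx_psd (R : realType) n (Z : 'M[R[i]]_n) : psdmx (absmx Z).
Proof. exact/sqrtmx_psd/gram_psd. Qed.

Lemma absmx_sqr (R : realType) n (Z : 'M[R[i]]_n) :
  absmx Z *m absmx Z = Z ^t* *m Z.
Proof. exact/sqrtmx_sqr/gram_psd. Qed.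

(* Main.v *)
Require Import Defs.
From mathcomp Require Import all_boot all_order all_fingroup all_algebra.
From mathcomp Require Import sesquilinear spectral complex reals lra.

Import Order.TTheory GRing.Theory Num.Theory.
Local Open Scope ring_scope.
Local Open Scope sesquilinear_scope.
Local Open Scope complex_scope.

Set Implicit Arguments.
Unset Strict Implicit.
Unset Printing Implicit Defensive.

(** Write Y = sum_k X_k, S = sum_k |X_k|_sym and s = lambda_(1+j)(S).

    The modulus dominates the numerical range: for a unimodular e, the Hermitian
    matrix eX + (eX)^* is bounded in form sense by +-2 |X|_sym
    ([norm_re_form_le]).  Indeed the Hermitian dilation H = [0, X; X^*, 0] has
    modulus diag(|X^*|, |X|), and |H| + H >= 0.  Summing over k, the Hermitian
    matrices T = Y + Y^* and U = iY + (iY)^* both satisfy |<Tv, v>| <= 2 <Sv, v>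
    ([norm_re_form_sum_le]).

    Let M be the spectral subspace of S, of codimension at most j, on which
    S <= s.  The h in M for which Th and Uh are also in M form a subspace of
    codimension at most 3j; for these, the compressions of T and U to M, of norm
    at most 2s, give |Th| <= 2s |h| and |Uh| <= 2s |h| ([herm_norm_le]).  This is
    where the factor 3 comes from: one copy of j for h, one for Th, one for Uh.

    Now |Th|^2 + |Uh|^2 = 2 (|Yh|^2 + |Y^*h|^2), while |Yh| and |Y^*h| are the
    norms of |Y|h and |Y^*|h, so convexity of the squared norm gives
    | |Y|_sym h | <= sqrt 2 s |h| on that subspace ([symabsmx_form_le]).  The
    min-max principle ([eig_down_le]) turns this into the bound on
    lambda_(1+3j)(|Y|_sym).

    To divide freely, s is replaced by an arbitrary c > s, hence c > 0, and the
    final bound follows by letting c tend to s.  Vectors are rows, so that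
    matrices act on the right and a subspace of codimension at most j is the
    kernel {v | v W = 0} of a matrix W with j columns. *)

(** * The real inner product on complex row vectors *)

Lemma ReD (R : realType) (x y : R[i]) :
  complex.Re (x + y) = complex.Re x + complex.Re y.
Proof. by case: x y => [a b] [c d]. Qed.

Lemma Re_realM (R : realType) (c : R) (x : R[i]) :
  complex.Re (c%:C * x) = c * complex.Re x.
Proof. by case: x => a b /=; rewrite mul0r subr0. Qed.

Lemma Re_conj (R : realType) (x : R[i]) : complex.Re (x^*) = complex.Re x.
Proof. by case: x. Qed.

Lemma Re_ge0 (R : realType) (x : R[i]) : 0 <= x -> 0 <= complex.Re x.
Proof. by rewrite lecE => /andP[]. Qed.

Lemma Re_sum (R : realType) (I : finType) (F : I -> R[i]) :
  complex.Re (\sum_i F i) = \sum_i complex.Re (F i).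
Proof. exact: (big_morph _ (@ReD R)). Qed.

Lemma trmxCM (R : realType) m n p (A : 'M[R[i]]_(m, n)) (B : 'M[R[i]]_(n, p)) :
  (A *m B) ^t* = B ^t* *m A ^t*.
Proof. by rewrite trmx_mul map_mxM. Qed.

Lemma trmxCD (R : realType) m n (A B : 'M[R[i]]_(m, n)) :
  (A + B) ^t* = A ^t* + B ^t*.
Proof. by rewrite linearD map_mxD. Qed.

Lemma trmxCZ (R : realType) m n a (A : 'M[R[i]]_(m, n)) :
  (a *: A) ^t* = a^* *: A ^t*.
Proof. by rewrite linearZ map_mxZ. Qed.

(** Only real parts of inner products are ever compared, so keeping them in R
    lets every quadratic inequality below be settled by real arithmetic. *)
Definition redot (R : realType) n (u v : 'rV[R[i]]_n) : R :=
  complex.Re ((u *m v ^t*) 0 0).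

Section Redot.
Variables (R : realType) (n : nat).
Implicit Types (u v w : 'rV[R[i]]_n) (A : 'M[R[i]]_n).

Lemma redotC u v : redot u v = redot v u.
Proof.
rewrite /redot -[u *m _]trmxCK trmxCM trmxCK mxE mxE; exact: Re_conj.
Qed.

Lemma redotDl u v w : redot (u + v) w = redot u w + redot v w.
Proof. by rewrite /redot mulmxDl mxE ReD. Qed.

Lemma redotDr u v w : redot w (u + v) = redot w u + redot w v.
Proof. by rewrite !(redotC w) redotDl. Qed.

Lemma redotZl (c : R) u v : redot (c%:C *: u) v = c * redot u v.
Proof. by rewrite /redot -scalemxAl mxE Re_realM. Qed.

Lemma redotZr (c : R) u v : redot u (c%:C *: v) = c * redot u v.
Proof. by rewrite redotC redotZl redotC. Qed.

Lemma redot_addZ (c : R) u v :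
  redot (u + c%:C *: v) (u + c%:C *: v)
    = redot u u + 2 * c * redot u v + c ^+ 2 * redot v v.
Proof.
by rewrite redotDl !redotDr !redotZl !redotZr (redotC v u); lra.
Qed.

Lemma redotE u : redot u u = \sum_i complex.Re (u 0 i * (u 0 i)^*).
Proof. by rewrite /redot mxE Re_sum; apply: eq_bigr => i _; rewrite !mxE. Qed.

Lemma redot_ge0 u : 0 <= redot u u.
Proof. by rewrite redotE sumr_ge0 // => i _; apply/Re_ge0/mul_conjC_ge0. Qed.

Lemma redot_gt0 u : u != 0 -> 0 < redot u u.
Proof.
move=> u0; rewrite lt_neqAle redot_ge0 andbT; apply: contraNneq u0 => /esym.
rewrite redotE => /psumr_eq0P u0; apply/eqP/rowP => i; rewrite mxE; apply/eqP.
have ui := mul_conjC_ge0 (u 0 i).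
rewrite -mul_conjC_eq0 -(RRe_real (ger0_real ui)) u0 // => k _.
exact/Re_ge0/mul_conjC_ge0.
Qed.

Lemma redot_adj u v A : redot (u *m A) v = redot u (v *m A ^t*).
Proof. by rewrite /redot trmxCM trmxCK mulmxA. Qed.

Lemma redot_diag u (d : 'I_n -> R) :
  redot (u *m diag_mx (\row_i (d i)%:C)) u
    = \sum_i d i * complex.Re (u 0 i * (u 0 i)^*).
Proof.
rewrite /redot mul_mx_diag mxE Re_sum; apply: eq_bigr => i _.
by rewrite !mxE -Re_realM mulrA [u 0 i * _]mulrC.
Qed.

Lemma psd_redot A v : psdmx A -> 0 <= redot (v *m A) v.
Proof. by case=> _ A0; apply/Re_ge0/A0. Qed.
End Redot.

(** * Eigenvalues and subspaces of given codimension *)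

Lemma eigs_nonincr (R : realType) n (A : 'M[R[i]]_n) i k :
  (i <= k)%N -> (k < n)%N -> nth 0 (eigs A) k <= nth 0 (eigs A) i.
Proof.
move=> ik kn.
have := sorted_leq_nth ge_trans ge_refl 0 (eigs_sorted A).
move=> /(_ i k); rewrite !inE size_eigs; apply => //.
exact: leq_ltn_trans kn.
Qed.

(** The rows of the unitary diagonalizing matrix are permuted so that the
    eigenvalues appear in the nonincreasing order used by [eigs]. *)
Lemma eigs_diagonalization (R : realType) n (A : 'M[R[i]]_n) :
  A \is hermsymmx ->
  exists2 P : 'M[R[i]]_n, P *m P ^t* = 1%:M &
    A = P ^t* *m diag_mx (\row_i (nth 0 (eigs A) i)%:C) *m P.
Proof.
move=> Ah; have AE := herm_spectralE Ah.
rewrite invspectralmx in AE.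
set Q := spectralmx A in AE; set d := spectral_diag A in AE.
have QQ : Q *m Q ^t* = 1%:M by apply/unitarymxP/spectral_unitarymx.
pose t := [tuple complex.Re (d 0 i) | i < n].
have /tuple_permP[p Ep] : perm_eq (eigs A) t.
  rewrite perm_sort -[val t]/(map _ _).
  rewrite (map_comp (@complex.Re R) (fun i => d 0 i)).
  exact/perm_map/herm_char_roots.
have nthE (i : 'I_n) : (nth 0 (eigs A) i)%:C = d 0 (p i).
  rewrite Ep (_ : nth 0 _ i = tnth [tuple tnth t (p i)  | i < n] i); last first.
    by rewrite (tnth_nth 0).
  rewrite !tnth_mktuple; apply: RRe_real.
  by have /mxOverP /(_ 0 (p i)) := hermitian_spectral_diag_real Ah.
exists (row_perm p Q).
  rewrite row_permE trmxCM mulmxA -(mulmxA _ Q) QQ mulmx1.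
  apply/matrixP => i j; rewrite !mxE (bigD1 (p i)) //= big1 => [|k kp].
    by rewrite !mxE eqxx mul1r addr0 (inj_eq perm_inj) eq_sym conjC_nat.
  by rewrite !mxE eq_sym (negPf kp) mul0r.
rewrite [LHS]AE; apply/matrixP => a b.
rewrite -!mulmxA !mxE (reindex_inj (@perm_inj _ p)); apply: eq_bigr => i _.
by rewrite !mul_diag_mx !mxE nthE.
Qed.

Lemma psd_eig_down_ge0 (R : realType) n (A : 'M[R[i]]_n) j :
  psdmx A -> 0 <= eig_down (1 + j) A.
Proof.
move=> Ap; rewrite /eig_down add1n /=.
have [jn|nj] := ltnP j n; last by rewrite nth_default ?size_eigs.
have [P PP AE] := eigs_diagonalization (proj1 Ap).
have := psd_redot (row (Ordinal jn) P) Ap; rewrite {1}AE !mulmxA redot_adj.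
rewrite -row_mul PP row1 redot_diag (bigD1 (Ordinal jn)) //= big1 => [|k kj].
  by rewrite !mxE !eqxx conjC1 mulr1 /= mulr1 addr0.
by rewrite !mxE (negPf kj) mul0r mulr0.
Qed.

(** The kernel of W is the span of the eigenvectors of index at least j: W
    extracts the first j coordinates in the sorted eigenbasis.  When j exceeds n
    it extracts all of them and the kernel is zero. *)
Lemma compression_below_eig (R : realType) n (A : 'M[R[i]]_n) j :
  A \is hermsymmx ->
  exists W : 'M[R[i]]_(n, j), forall v : 'rV_n, v *m W = 0 ->
    redot (v *m A) v <= eig_down (1 + j) A * redot v v.
Proof.
move=> Ah; have [P PP AE] := eigs_diagonalization Ah.
exists (P ^t* *m pid_mx j) => v; rewrite mulmxA.
set y := v *m P ^t* => yW.
have PP' : P ^t* *m P = 1%:M by apply: mulmx1C.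
have vE : v = y *m P by rewrite /y -mulmxA PP' mulmx1.
have -> : redot v v = redot y y.
  by rewrite {1}vE redot_adj.
rewrite {1}AE !mulmxA -/y redot_adj -/y redot_diag redotE mulr_sumr.
apply: ler_sum => i _.
have [ij|ji] := ltnP i j.
  have -> : y 0 i = 0; last by rewrite mul0r !mulr0.
  have /matrixP/(_ 0 (Ordinal ij)) := yW.
  rewrite [LHS]mxE [RHS]mxE (bigD1 i) //= big1 ?addr0 => [|k ki].
    by rewrite [X in _ * X]mxE /= eqxx ij mulr1.
  by rewrite [X in _ * X]mxE /= (inj_eq val_inj) (negPf ki) mulr0.
apply: ler_wpM2r; first exact/Re_ge0/mul_conjC_ge0.
rewrite /eig_down add1n /=.
exact: eigs_nonincr ji (ltn_ord i).
Qed.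

(** The easy half of the Courant-Fischer min-max principle: the span of the
    first j + 1 eigenvectors meets every subspace of codimension at most j, and
    on that span the form is at least the (j + 1)-st eigenvalue. *)
Lemma eig_down_le (R : realType) n (A : 'M[R[i]]_n) j (W : 'M[R[i]]_(n, j)) c :
  A \is hermsymmx -> (j < n)%N ->
  (forall v : 'rV_n, v *m W = 0 -> redot (v *m A) v <= c * redot v v) ->
  eig_down (1 + j) A <= c.
Proof.
move=> Ah jn Hc; have [P PP AE] := eigs_diagonalization Ah.
pose I0 : 'M[R[i]]_(j.+1, n) := pid_mx j.+1.
(* Coefficients, on the first j + 1 eigenvectors, of the vectors killed by W. *)
pose K := kermx (I0 *m P *m W).
have : K != 0.
  rewrite kermx_eq0 /row_free; apply: contraTneq (rank_leq_col (I0 *m P *m W)).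
  by move=> ->; rewrite -ltnNge.
case/rowV0Pn => u /sub_kermxP; rewrite !mulmxA.
set y := u *m I0 => yW u0.
have y0 : y != 0.
  apply: contraNneq u0 => y0.
  have I01 : I0 *m pid_mx j.+1 = 1%:M :> 'M_j.+1.
    by rewrite pid_mx_id // pid_mx_1.
  by rewrite -[u]mulmx1 -I01 mulmxA -/y y0 mul0mx.
have := Hc _ yW.
have yPP : y *m P *m P ^t* = y by rewrite -mulmxA PP mulmx1.
rewrite [redot (y *m P) _]redot_adj yPP {1}AE !mulmxA redot_adj !yPP redot_diag.
move=> cy.
have : eig_down (1 + j) A * redot y y <= c * redot y y.
  apply: le_trans cy; rewrite redotE mulr_sumr; apply: ler_sum => i _.
  have [ij|ji] := leqP i j; last first.
    suff -> : y 0 i = 0 by rewrite mul0r !mulr0.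
    rewrite mxE big1 // => k _; rewrite mxE.
    case: eqP => //= [ki|_]; last by rewrite mulr0.
    by have := ltn_ord k; rewrite ki ltnS leqNgt ji.
  apply: ler_wpM2r; first exact/Re_ge0/mul_conjC_ge0.
  rewrite /eig_down add1n /=.
  exact: eigs_nonincr ij jn.
by rewrite ler_pM2r // redot_gt0.
Qed.

(** * The modulus dominates the numerical range *)

Lemma unitary_conjM (K : pzRingType) n (P Q D E : 'M[K]_n) : P *m Q = 1%:M ->
  (Q *m D *m P) *m (Q *m E *m P) = Q *m (D *m E) *m P.
Proof. by move=> PQ; rewrite !mulmxA -(mulmxA _ P) PQ mulmx1. Qed.

(** In an eigenbasis of H, by uniqueness of the square root, |H| has the moduli
    of the eigenvalues of H on its diagonal, and |d| + d >= 0. *)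
Lemma herm_add_absmx_psd (R : realType) n (H : 'M[R[i]]_n) :
  H \is hermsymmx -> psdmx (absmx H + H).
Proof.
move=> Hh; have HE := herm_spectralE Hh; rewrite invspectralmx in HE.
set Q := spectralmx H in HE; set d := spectral_diag H in HE.
have QQ : Q *m Q ^t* = 1%:M by apply/unitarymxP/spectral_unitarymx.
have dr i : d 0 i \is Num.real.
  by have /mxOverP /(_ 0 i) := hermitian_spectral_diag_real Hh.
pose a : 'rV_n := \row_i `|d 0 i|.
have aa : diag_mx a *m diag_mx a = diag_mx d *m diag_mx d.
  rewrite !mulmx_diag; congr diag_mx.
  by apply/rowP => i; rewrite !mxE -!expr2 real_normK.
have -> : absmx H = Q ^t* *m diag_mx a *m Q.
  apply/esym/sqrtmx_unique; first exact: gram_psd.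
    by apply: conj_diag_psd => i; rewrite mxE.
  have conjM D E : _ = _ := @unitary_conjM R[i] n Q (Q ^t*) D E QQ.
  by rewrite conjM aa -conjM -HE (hermE Hh).
rewrite HE -mulmxDl -mulmxDr -linearD; apply: conj_diag_psd => i.
rewrite !mxE -[X in _ + X]opprK subr_ge0 -normrN.
by apply: real_ler_norm; rewrite realN.
Qed.

Lemma psd_block_diag (R : realType) n1 n2 (A : 'M[R[i]]_n1) (B : 'M[R[i]]_n2) :
  psdmx A -> psdmx B -> psdmx (block_mx A 0 0 B).
Proof.
move=> [Ah A0] [Bh B0]; split.
  apply/is_hermitianmxP; rewrite expr0 scale1r.
  by rewrite tr_block_mx map_block_mx !trmx0 !map_mx0 (hermE Ah) (hermE Bh).
move=> v; rewrite -[v]hsubmxK mul_row_block !mulmx0 addr0 add0r.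
by rewrite tr_row_mx map_col_mx mul_row_col mxE addr_ge0.
Qed.

Lemma block_diag_sqr (K : pzRingType) n1 n2 (A : 'M[K]_n1) (B : 'M[K]_n2) :
  block_mx A 0 0 B *m block_mx A 0 0 B = block_mx (A *m A) 0 0 (B *m B).
Proof. by rewrite mulmx_block !(mulmx0, mul0mx, addr0, add0r). Qed.

Lemma block_antidiag_sqr (K : pzRingType) n1 n2
    (A : 'M[K]_(n1, n2)) (B : 'M[K]_(n2, n1)) :
  block_mx 0 A B 0 *m block_mx 0 A B 0 = block_mx (A *m B) 0 0 (B *m A).
Proof. by rewrite mulmx_block !(mulmx0, mul0mx, addr0, add0r). Qed.

(** Doubling a vector tests a 2 x 2 block matrix against the sum of its diagonal
    blocks plus the sum of its off-diagonal blocks. *)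
Lemma block_form_twice (K : pzRingType) n (A B C D : 'M[K]_n)
    (u : 'rV[K]_n) (v : 'cV[K]_n) :
  row_mx u u *m (block_mx A 0 0 B + block_mx 0 C D 0) *m col_mx v v
    = u *m (B + A) *m v + u *m (C + D) *m v.
Proof.
rewrite add_block_mx !(add0r, addr0) mul_row_block mul_row_col.
by rewrite !mulmxDr !mulmxDl (AC (2*2) ((4*1)*(3*2))).
Qed.

(** The Hermitian dilation H of X squares to diag(X X^*, X^* X), so its modulus
    is diag(|X^*|, |X|); positivity of |H| + H is tested on the vector
    (v, v). *)
Lemma re_form_le_abs (R : realType) n (X : 'M[R[i]]_n) v :
  0 <= redot (v *m (absmx X + absmx (X ^t*))) v + redot (v *m (X + X ^t*)) v.
Proof.
pose H := block_mx 0 X (X ^t*) 0.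
pose B := block_mx (absmx (X ^t*)) 0 0 (absmx X).
have Ht : H ^t* = H.
  by rewrite /H tr_block_mx map_block_mx !trmx0 !map_mx0 trmxCK.
have BE : B = absmx H.
  apply: sqrtmx_unique; first exact: gram_psd.
    by apply: psd_block_diag; apply: absmx_psd.
  by rewrite Ht block_diag_sqr block_antidiag_sqr !absmx_sqr trmxCK.
have : psdmx (B + H).
  rewrite BE; apply: herm_add_absmx_psd.
  by apply/is_hermitianmxP; rewrite expr0 scale1r Ht.
move=> /(psd_redot (row_mx v v)).
by rewrite /redot tr_row_mx map_col_mx block_form_twice mxE ReD.
Qed.

Lemma redot_unimodular (R : realType) n e (u : 'rV[R[i]]_n) : e * e^* = 1 ->
  redot (e *: u) (e *: u) = redot u u.
Proof.
by move=> e1; rewrite /redot trmxCZ -scalemxAl -scalemxAr scalerA e1 scale1r.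
Qed.

Lemma redot_sum (R : realType) n m (A : 'I_m -> 'M[R[i]]_n) u v :
  redot (u *m \sum_k A k) v = \sum_k redot (u *m A k) v.
Proof.
elim/big_rec2: _ => [|k x y _ <-]; last by rewrite mulmxDr redotDl.
by rewrite /redot mulmx0 mul0mx mxE.
Qed.

Lemma psdmxD (R : realType) n (A B : 'M[R[i]]_n) :
  psdmx A -> psdmx B -> psdmx (A + B).
Proof.
move=> [Ah A0] [Bh B0]; split.
  by apply/is_hermitianmxP; rewrite expr0 scale1r trmxCD (hermE Ah) (hermE Bh).
by move=> v; rewrite mulmxDr mulmxDl mxE addr_ge0.
Qed.

Lemma psdmxZ (R : realType) n (a : R[i]) (A : 'M[R[i]]_n) :
  0 <= a -> psdmx A -> psdmx (a *: A).
Proof.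
move=> a0 [Ah A0]; split.
  apply/is_hermitianmxP; rewrite expr0 scale1r trmxCZ (hermE Ah).
  by congr (_ *: _); apply/esym/CrealP/ger0_real.
by move=> v; rewrite -scalemxAr -scalemxAl mxE mulr_ge0.
Qed.

Lemma psdmx_sum (R : realType) n m (A : 'I_m -> 'M[R[i]]_n) :
  (forall k, psdmx (A k)) -> psdmx (\sum_k A k).
Proof.
move=> Ap; elim/big_ind: _ => //; last exact: psdmxD.
split; last by move=> v; rewrite mulmx0 mul0mx mxE.
by apply/is_hermitianmxP; rewrite expr0 scale1r trmx0 map_mx0.
Qed.

Lemma symabsmx_psd (R : realType) n (X : 'M[R[i]]_n) : psdmx (symabsmx X).
Proof.
by apply: psdmxZ; [rewrite invr_ge0 | apply: psdmxD; apply: absmx_psd].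
Qed.

Lemma symabsmx_double (R : realType) n (X : 'M[R[i]]_n) :
  absmx X + absmx (X ^t*) = (2 : R)%:C *: symabsmx X.
Proof.
rewrite /symabsmx scalerA (_ : _ * _ = 1) ?scale1r // rmorph_nat.
by rewrite divff // pnatr_eq0.
Qed.

Lemma symabsmx_unimodular (R : realType) n e (X : 'M[R[i]]_n) : e * e^* = 1 ->
  symabsmx (e *: X) = symabsmx X.
Proof.
move=> e1; rewrite /symabsmx /absmx !trmxCZ conjCK.
by rewrite -!scalemxAl -!scalemxAr !scalerA [e^* * e]mulrC e1 !scale1r.
Qed.

(** The upper bound for X is the lower bound for -X, which has the same symmetric
    modulus. *)
Lemma norm_re_form_le (R : realType) n (X : 'M[R[i]]_n) v :
  `|redot (v *m (X + X ^t*)) v| <= 2 * redot (v *m symabsmx X) v.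
Proof.
have le X' : - (2 * redot (v *m symabsmx X') v) <= redot (v *m (X' + X' ^t*)) v.
  rewrite lerNl -subr_ge0 opprK -redotZl scalemxAr -symabsmx_double.
  exact: re_form_le_abs.
have leN := le ((-1) *: X); move: leN (le X).
rewrite symabsmx_unimodular; last by rewrite rmorphN1 mulrNN mulr1.
have -> : (-1) *: X + ((-1) *: X) ^t* = (-1)%:C *: (X + X ^t*).
  by rewrite trmxCZ rmorphN1 -scalerDr rmorphN1.
rewrite -[v *m (_%:C *: _)]scalemxAr redotZl mulN1r lerN2 => leN leX.
by rewrite ler_norml leX leN.
Qed.

(** The forms, unlike the moduli, are additive in X, so the bound survives
    summation. *)
Lemma norm_re_form_sum_le (R : realType) n m (X : 'I_m -> 'M[R[i]]_n) e v :
  e * e^* = 1 ->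
  `|redot (v *m (e *: (\sum_k X k) + (e *: (\sum_k X k)) ^t*)) v|
     <= 2 * redot (v *m \sum_k symabsmx (X k)) v.
Proof.
move=> e1.
have -> : e *: (\sum_k X k) + (e *: (\sum_k X k)) ^t*
    = \sum_k (e *: X k + (e *: X k) ^t*).
  rewrite big_split /= scaler_sumr; congr (_ + _).
  rewrite linear_sum; apply: (big_morph _ (@map_mxD _ _ _ _ _)).
  by rewrite map_mx0.
rewrite !redot_sum mulr_sumr; apply: le_trans (ler_norm_sum _ _ _) _.
apply: ler_sum => k _.
by rewrite -(symabsmx_unimodular (X k) e1) norm_re_form_le.
Qed.

(** * Norm bounds on the subspace of codimension 3j *)

(** A Hermitian form bounded by c on the subspace M = ker W has a compression to
    M of operator norm at most c; when Th lies in M, the compression acts on h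
    as T itself.  In place of polarization, the upper bound is applied to
    Th + c h and the lower bound to Th - c h: in the sum, the terms other than
    |Th|^2 and |h|^2 cancel. *)
Lemma herm_norm_le (R : realType) n p (T : 'M[R[i]]_n) (W : 'M[R[i]]_(n, p))
    (c : R) (h : 'rV[R[i]]_n) : T ^t* = T -> 0 < c ->
  (forall v : 'rV_n, v *m W = 0 ->
     `|redot (v *m T) v| <= c * redot v v) ->
  h *m W = 0 -> h *m T *m W = 0 ->
  redot (h *m T) (h *m T) <= c ^+ 2 * redot h h.
Proof.
move=> Tt c0 Hc hW hTW; set g := h *m T in hTW *.
have : (g + c%:C *: h) *m W = 0.
  by rewrite mulmxDl -scalemxAl hW hTW scaler0 addr0.
have : (g + (- c)%:C *: h) *m W = 0.
  by rewrite mulmxDl -scalemxAl hW hTW scaler0 addr0.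
move=> /Hc /ler_normlP[+ _] /Hc /ler_normlP[_].
have gT : redot (g *m T) h = redot g g by rewrite redot_adj Tt.
have formE (a : R) : redot ((g + a%:C *: h) *m T) (g + a%:C *: h)
    = redot (g *m T) g + a * redot g g + (a * redot g g + a * (a * redot g h)).
  rewrite mulmxDl -scalemxAl -/g redotDl redotZl !redotDr !redotZr gT.
  by rewrite mulrDr.
rewrite [X in - X <= _](formE (- c)) [X in _ <= _ * X](redot_addZ (- c) g h).
move=> le_neg.
rewrite [X in X <= _](formE c) [X in _ <= _ * X](redot_addZ c g h).
move: le_neg.
move: (redot g g) (redot (g *m T) g) (redot g h) (redot h h) => q r s N H1 H2.
by rewrite -(ler_pM2l c0); lra.
Qed.

Lemma mul_row_mx3_eq0 (K : pzRingType) n p (h : 'rV[K]_n)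
    (W : 'M[K]_(n, p)) (A B : 'M[K]_n) :
  h *m row_mx W (row_mx (A *m W) (B *m W)) = 0 ->
  [/\ h *m W = 0, h *m A *m W = 0 & h *m B *m W = 0].
Proof.
rewrite !mul_mx_row => /eqP; rewrite !row_mx_eq0 !mulmxA.
by case/and3P=> /eqP ? /eqP ? /eqP ?.
Qed.

(** The parallelogram law: the two vectors on the left are hY + hY^* and
    i (hY - h Y^* ). *)
Lemma cartesian_parallelogram (R : realType) n (Y : 'M[R[i]]_n) h :
  redot (h *m (Y + Y ^t*)) (h *m (Y + Y ^t*))
    + redot (h *m ('i *: Y + ('i *: Y) ^t*)) (h *m ('i *: Y + ('i *: Y) ^t*))
  = 2 * (redot (h *m Y) (h *m Y) + redot (h *m Y ^t*) (h *m Y ^t*)).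
Proof.
have -> : 'i *: Y + ('i *: Y) ^t* = 'i *: (Y + (-1)%:C *: Y ^t*).
  rewrite trmxCZ conjCi scalerDr scalerA; congr (_ + _ *: _).
  by rewrite rmorphN1 mulrN1.
rewrite -scalemxAr redot_unimodular; last first.
  by rewrite conjCi mulrN -expr2 sqrCi opprK.
rewrite !mulmxDr -scalemxAr; move: (h *m Y) (h *m Y ^t*) => a b.
have := redot_addZ 1 a b; rewrite scale1r => ->.
by rewrite (redot_addZ (-1) a b); lra.
Qed.

(** With w the mean of p and q, convexity of the squared norm gives
    |w| <= d |h|, and then <w, h> <= d |h|^2 by Cauchy-Schwarz.  Both steps are
    expansions of squares: |p - q|^2 >= 0 and |p + q - 2 d h|^2 >= 0. *)
Lemma redot_mean_le (R : realType) n (p q w h : 'rV[R[i]]_n) (d : R) : 0 < d ->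
  p + q = (2 : R)%:C *: w ->
  redot p p + redot q q <= 2 * d ^+ 2 * redot h h ->
  redot w h <= d * redot h h.
Proof.
move=> d0 wE.
have := redot_addZ 1 p q; rewrite scale1r.
have := redot_ge0 (p + (-1)%:C *: q); rewrite redot_addZ.
have := redot_ge0 (p + q + (- (2 * d))%:C *: h); rewrite redot_addZ.
rewrite [redot (p + q) h](_ : _ = 2 * redot w h); last by rewrite wE redotZl.
move: (redot (p + q) (p + q)) => s.
move: (redot p p) (redot q q) (redot p q) (redot h h) (redot w h).
move=> pp qq pq N r.
by move=> H1 H2 sE H3; rewrite sE in H1; rewrite -(ler_pM2l d0); lra.
Qed.

(** |Y|_sym h is the mean of |Y| h and |Y^*| h, whose norms are those of Y and
    Y^* applied to h; as vectors are rows, the two norms are swapped. *)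
Lemma symabsmx_form_le (R : realType) n (Y : 'M[R[i]]_n) h (c : R) : 0 < c ->
  redot (h *m Y) (h *m Y) + redot (h *m Y ^t*) (h *m Y ^t*)
    <= 4 * c ^+ 2 * redot h h ->
  redot (h *m symabsmx Y) h <= Num.sqrt 2 * c * redot h h.
Proof.
move=> c0; set d := Num.sqrt 2 * c.
have d0 : 0 < d by rewrite mulr_gt0 // sqrtr_gt0.
have d2 : 2 * c ^+ 2 = d ^+ 2 by rewrite exprMn sqr_sqrtr.
have abs_sqr Z : redot (h *m absmx Z) (h *m absmx Z)
    = redot (h *m Z ^t*) (h *m Z ^t*).
  rewrite redot_adj (hermE (proj1 (absmx_psd Z))) -mulmxA absmx_sqr.
  by rewrite redotC mulmxA redot_adj.
have := abs_sqr (Y ^t*); rewrite trmxCK => <-; rewrite -abs_sqr.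
rewrite (_ : 4 * c ^+ 2 = 2 * d ^+ 2); last by rewrite -d2 [RHS]mulrA -natrM.
apply: redot_mean_le => //.
by rewrite -mulmxDr addrC symabsmx_double scalemxAr.
Qed.

(** * The eigenvalue inequality *)

Theorem corollary2p4 (R : realType) (n m : nat) (X : 'I_m -> 'M[R[i]]_n)
    (j : nat) :
  eig_down (1 + 3 * j) (symabsmx (\sum_(k < m) X k))
    <= Num.sqrt 2 * eig_down (1 + j) (\sum_(k < m) symabsmx (X k)).
Proof.
set Y := \sum_k X k; set S := \sum_k symabsmx (X k).
have Sp : psdmx S by apply: psdmx_sum => k; apply: symabsmx_psd.
have s0 := psd_eig_down_ge0 j Sp.
set s := eig_down (1 + j) S in s0 *.
have r2 : 0 < Num.sqrt (2 : R) by rewrite sqrtr_gt0.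
have [nj|jn] := leqP n (3 * j).
  by rewrite {1}/eig_down nth_default ?size_eigs ?add1n // mulr_ge0 // ltW.
(* A strict upper bound c of s is positive, even when s is zero. *)
suff le_c c : s < c -> eig_down (1 + 3 * j) (symabsmx Y) <= Num.sqrt 2 * c.
  apply/ler_addgt0Pr => e e0.
  have -> : Num.sqrt 2 * s + e = Num.sqrt 2 * (s + e / Num.sqrt 2).
    by rewrite mulrDr mulrCA divff ?mulr1 // gt_eqF.
  by apply: le_c; rewrite ltrDl divr_gt0.
move=> sc; have c0 : 0 < c by exact: le_lt_trans sc.
have [W HW] := compression_below_eig j (proj1 Sp).
pose H e := e *: Y + (e *: Y) ^t*.
have Ht e : (H e) ^t* = H e by rewrite /H trmxCD trmxCK addrC.
have Hle e : e * e^* = 1 -> forall v : 'rV_n, v *m W = 0 ->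
    `|redot (v *m H e) v| <= (2 * c) * redot v v.
  move=> e1 v vW; apply: le_trans (norm_re_form_sum_le X v e1) _.
  rewrite -mulrA ler_pM2l //; apply: le_trans (HW v vW) _.
  by rewrite ler_wpM2r ?redot_ge0 // ltW.
have e3 : (3 * j = j + (j + j))%N by rewrite !mulSn mul0n addn0.
move: jn; rewrite e3 => jn.
(* ker W3 consists of the h such that h, h H(1) and h H(i) lie in ker W. *)
pose W3 := row_mx W (row_mx (H 1 *m W) (H 'i *m W)).
apply: (@eig_down_le _ _ _ _ W3) => // [|h].
  exact: (proj1 (symabsmx_psd Y)).
case/(@mul_row_mx3_eq0 R[i]) => hW h1W hiW.
apply: (symabsmx_form_le c0).
have c2 : 0 < 2 * c by exact: mulr_gt0.
have one1 : (1 : R[i]) * 1^* = 1 by rewrite conjC1 mulr1.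
have ii1 : ('i : R[i]) * 'i^* = 1 by rewrite conjCi mulrN -expr2 sqrCi opprK.
have le1 := herm_norm_le (Ht 1) c2 (Hle _ one1) hW h1W.
have lei := herm_norm_le (Ht 'i) c2 (Hle _ ii1) hW hiW.
have := lerD le1 lei.
rewrite {1 2}/H scale1r cartesian_parallelogram.
rewrite [X in _ <= X](_ : _ = 2 * ((2 * c) ^+ 2 * redot h h)); last first.
  by rewrite [RHS]mulr_natl mulr2n.
by rewrite ler_pM2l // exprMn -natrX.
Qed.
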